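(* Let $X=H(D)$ endowed with the topology of uniform convergence on each compact subset of $D$, or $X=A(D)$ endowed with the supremum norm. Then the sets $$L_1(X)=\{g\in X: Y_1(g)\neq\emptyset\}\quad\text{and}\quad L_2(X)=\{g\in X: Y_3(g)\neq\emptyset\}$$ are dense in $X$.
   Context: $D=\{z\in\mathbb{C}:|z|<1\}$. $H(D)$ is the space of holomorphic functions on $D$, $H^\infty(D)$ the space of bounded holomorphic functions on $D$, and $A(D)$ the space of functions holomorphic on $D$ which extend continuously to $\overline{D}$. For $g\in H(D)$ the Volterra operator $T_g:H(D)\to H(D)$ sends $f\in H(D)$ to the antiderivative of $fg'$ on $D$ vanishing at $0$. Set $Y_1(g)=\{f\in A(D): T_g(f)\notin H^\infty(D)\}$ and $Y_3(g)=\{f\in H^\infty(D): T_g(f)\notin H^\infty(D)\}$. *)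

(* Defs.v *)
From HB Require Import structures.
From mathcomp Require Import all_boot all_order all_algebra.
From mathcomp Require Import complex.
From mathcomp Require Import all_classical all_reals.
From mathcomp Require Import topology normedtype derive.

Set Implicit Arguments.
Unset Strict Implicit.
Unset Printing Implicit Defensive.

Import Order.TTheory GRing.Theory Num.Theory numFieldNormedType.Exports.
Local Open Scope classical_set_scope.
Local Open Scope complex_scope.
Local Open Scope ring_scope.

(* The complex numbers, typed as a [numClosedFieldType] so that they inherit
   the normed topology of numeric fields; [derivable f z 1] over this field is
   complex differentiability. *)
Definition cplx (R : realType) : numClosedFieldType := R[i].

Section Disc.
Variable R : realType.
Local Notation C := (cplx R).

Definition disc : set C := [set z | `|z| < 1].
Definition cdisc : set C := [set z | `|z| <= 1].

(* A function on the disc is represented by its extension by 0 to the whole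
   plane, so that equality in [HD] is equality on the disc. *)
Definition hol_disc : {pred C -> C} :=
  mem [set f : C -> C | (forall z, disc z -> derivable f z 1) /\
                        (forall z, ~ disc z -> f z = 0)].

Lemma hol_discP (f : C -> C) : reflect
  ((forall z, disc z -> derivable f z 1) /\ (forall z, ~ disc z -> f z = 0))
  (f \in hol_disc).
Proof. by apply: (iffP idP) => [/set_mem|/mem_set]. Qed.

Lemma hol_disc_submod : submod_closed hol_disc.
Proof.
split.
  apply/hol_discP; split => [z _|//].
  exact: (@derivable_cst _ _ _ (0 : C)).
move=> a f g /hol_discP[df f0] /hol_discP[dg g0]; apply/hol_discP; split.
  move=> z Dz; apply: derivableD; last exact: dg.
  by apply: derivableZ; exact: df.
by move=> z nDz; rewrite !fctE f0// g0// scaler0 addr0.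
Qed.
HB.instance Definition _ :=
  GRing.isSubmodClosed.Build C (C -> C) hol_disc hol_disc_submod.

Record HD := MkHD { HD_fun :> C -> C; _ : HD_fun \in hol_disc }.

HB.instance Definition _ := [isSub for HD_fun].
HB.instance Definition _ := [Choice of HD by <:].
HB.instance Definition _ := [SubChoice_isSubLmodule of HD by <:].

HB.instance Definition _ := Topological.copy HD
  (initial_topology
    (HD_fun : HD -> {family [set K | compact K /\ K `<=` disc], C -> C})).

Definition Hinf : set HD := [set f | [bounded f z | z in disc]].

Definition disc_algebra : {pred HD} :=
  mem [set f : HD | exists2 F : C -> C,
    {within cdisc, continuous F} & {in disc, F =1 f}].

Lemma disc_algebraP (f : HD) : reflect
  (exists2 F : C -> C, {within cdisc, continuous F} & {in disc, F =1 f})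
  (f \in disc_algebra).
Proof. by apply: (iffP idP) => [/set_mem|/mem_set]. Qed.

Lemma disc_algebra_submod : submod_closed disc_algebra.
Proof.
split.
  by apply/disc_algebraP; exists (fun=> 0) => // x; exact: cvg_cst.
move=> a f g /disc_algebraP[F cF Ff] /disc_algebraP[G cG Gg].
apply/disc_algebraP; exists (fun z => a *: F z + G z) => [x|z Dz].
  by apply: cvgD; [apply: cvgZr; exact: cF|exact: cG].
by rewrite Ff// Gg.
Qed.
HB.instance Definition _ :=
  GRing.isSubmodClosed.Build C HD disc_algebra disc_algebra_submod.

Record AD := MkAD { AD_HD :> HD; _ : AD_HD \in disc_algebra }.

HB.instance Definition _ := [isSub for AD_HD].
HB.instance Definition _ := [Choice of AD by <:].
HB.instance Definition _ := [SubChoice_isSubLmodule of AD by <:].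

Lemma cplx_normE (z : C) : `|z| = (complex.Re `|z|)%:C.
Proof. by rewrite normc_def. Qed.

Lemma Re_norm_le (z : C) :
  `|complex.Re z|%:C <= `|z| /\ `|complex.Im z|%:C <= `|z|.
Proof.
case: z => a b; rewrite normc_def /= !lecR -!sqrtr_sqr.
by split; apply: ler_wsqrtr; rewrite ?lerDl ?lerDr sqr_ge0.
Qed.

Lemma Complex_continuous : continuous (fun p : R * R => Complex p.1 p.2 : C).
Proof.
move=> [a b] /=; apply/cvgrPdist_lt => e e0.
have eE : e = (complex.Re e)%:C.
  by case: e e0 => x y; rewrite ltcE /= => /andP[/eqP -> _].
have r0 : 0 < complex.Re e by move: e0; rewrite eE ltcR.
have r20 : 0 < complex.Re e / 2 by rewrite divr_gt0.
exists (ball a (complex.Re e / 2), ball b (complex.Re e / 2)) => /=.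
  by split; exact: nbhsx_ballx.
move=> [x y] [/= ax yb].
have -> : (Complex a b : C) - Complex x y = (a - x)%:C + 'i * (b - y)%:C.
  by apply/eqP; rewrite eq_complex /= !(mul0r, mul1r, mulr0, addr0, add0r, sub0r, subr0) !eqxx.
rewrite (le_lt_trans (ler_normD _ _))// normrM normCi mul1r !normc_def /=.
rewrite !expr0n !addr0 !sqrtr_sqr -rmorphD /= eE ltcR.
by rewrite [ltRHS]splitr ltrD.
Qed.

Lemma Re_norm_continuous : continuous (fun z : C => complex.Re `|z|).
Proof.
move=> z; have FF : Filter (nbhs z) by exact: nbhs_filter.
apply/(@cvgrPdist_lt _ _ _ _ FF) => e e0.
have e0' : (0 : C) < e%:C by rewrite ltcR.
apply/(@nbhs_ballP C C z); exists (e%:C) => // w; rewrite -ball_normE /= => zw.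
rewrite -ltcR; apply: le_lt_trans zw.
rewrite [leRHS]cplx_normE lecR ler_distl lerBlDr -!lecR !rmorphD /= -!cplx_normE; apply/andP; split.
  by rewrite -{1}(subrK z w) addrC distrC ler_normD.
by rewrite -{1}(subrK w z) addrC ler_normD.
Qed.

Lemma cdisc_compact : compact cdisc.
Proof.
pose K : set C := (fun p : R * R => Complex p.1 p.2 : C) @`
  (`[-1, 1]%classic `*` `[-1, 1]%classic).
have cK : compact K.
  apply: continuous_compact.
    by apply: continuous_subspaceT; exact: Complex_continuous.
  by apply: compact_setX; exact: segment_compact.
apply: (subclosed_compact _ cK).
  move=> z clz; rewrite /cdisc /=.
  have [//|z1] := real_leP (normr_real z) (@real1 C).
  have z10 : 0 < `|z| - 1 by rewrite subr_gt0.
  have [w [/= w1]] := clz _ (nbhsx_ballx z _ z10).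
  rewrite -ball_normE /= => zw.
  suff : `|z| < `|z| by rewrite ltxx.
  rewrite -{1}(subrK w z) (le_lt_trans (ler_normD _ _))//.
  by rewrite -[ltRHS](subrK 1) ltr_leD.
move=> z Dz; have [zr zi] := Re_norm_le z.
exists (complex.Re z, complex.Im z) => /=; last by case: (z).
by split; rewrite /= in_itv /= -ler_norml -lecR;
  [apply: le_trans zr _|apply: le_trans zi _].
Qed.

Lemma disc_algebra_bounded (f : AD) : (f : HD) \in Hinf.
Proof.
apply/mem_set.
case: f => f /= /disc_algebraP[F cF Ff].
have cFD : compact ((fun z => complex.Re `|F z|) @` cdisc).
  apply: continuous_compact; last exact: cdisc_compact.
  move=> x; apply: (@continuous_comp _ _ _ (F : subspace cdisc -> C)
    (fun w : C => complex.Re `|w|)); first exact: cF.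
  exact: Re_norm_continuous.
have [M [Mr MF]] := compact_bounded cFD; exists (M%:C); split.
  by rewrite complex_real.
move=> x Mx z Dz.
have xE : x = (complex.Re x)%:C.
  by case: x Mx => u v; rewrite ltcE /= => /andP[/eqP -> _].
rewrite /= -Ff ?inE// cplx_normE xE lecR (le_trans (ler_norm _))//.
by apply: (MF _ _ (complex.Re `|F z|)); [rewrite -ltcR -xE|exists z => //; exact: ltW].
Qed.

Definition sup_norm (f : C -> C) : R := sup [set complex.Re `|f z| | z in disc].

(* The norm of a normed module over the complex numbers takes its (real) values
   in the complex numbers, hence the injection. *)
Definition AD_norm (f : AD) : C := (sup_norm f)%:C.

Lemma disc0 : disc 0. Proof. by rewrite /disc /= normr0 ltr01. Qed.

Lemma sup_norm_has_sup (f : AD) :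
  has_sup [set complex.Re `|f z| | z in disc].
Proof.
split; first by exists (complex.Re `|f 0|), 0 => //; exact: disc0.
have /set_mem[M [Mr MF]] := disc_algebra_bounded f.
exists (complex.Re (M + 1)) => _ [z Dz <-].
have := MF (M + 1); rewrite ltrDl ltr01 => /(_ erefl z Dz) /=.
by rewrite lecE => /andP[].
Qed.

Lemma sup_norm_ge (f : AD) z : disc z -> complex.Re `|f z| <= sup_norm f.
Proof.
move=> Dz; apply: sup_upper_bound; first exact: sup_norm_has_sup.
by exists z.
Qed.

Lemma sup_norm_le (f : AD) x :
  (forall z, disc z -> complex.Re `|f z| <= x) -> sup_norm f <= x.
Proof.
move=> fx; apply: ge_sup; first by case: (sup_norm_has_sup f).
by move=> _ [z Dz <-]; exact: fx.
Qed.

Lemma sup_norm_ge0 (f : AD) : 0 <= sup_norm f.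
Proof.
apply: le_trans (sup_norm_ge f disc0); by rewrite normc_def /= sqrtr_ge0.
Qed.

Lemma AD_normD (f g : AD) : AD_norm (f + g) <= AD_norm f + AD_norm g.
Proof.
rewrite /AD_norm -rmorphD lecR; apply: (@sup_norm_le (f + g)) => z Dz.
apply: le_trans (lerD (sup_norm_ge f Dz) (sup_norm_ge g Dz)).
by rewrite -lecR rmorphD /= -!cplx_normE; exact: ler_normD.
Qed.

Lemma AD_normZ_le (a : C) (f : AD) : AD_norm (a *: f) <= `|a| * AD_norm f.
Proof.
rewrite /AD_norm (cplx_normE a) -rmorphM lecR; apply: (@sup_norm_le (a *: f)) => z Dz.
apply: (@le_trans _ _ (complex.Re `|a| * complex.Re `|f z|)).
  by rewrite -lecR rmorphM /= -!cplx_normE -normrM.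
apply: ler_wpM2l (sup_norm_ge f Dz).
by rewrite normc_def /= sqrtr_ge0.
Qed.

Lemma AD_norm0_eq0 (f : AD) : AD_norm f = 0 -> f = 0.
Proof.
move=> [f0]; apply/val_inj/val_inj/funext => z /=.
have [Dz|nDz] := pselect (disc z); last first.
  by case: f {f0} => -[f /= /hol_discP[_ f0] _]; exact: f0.
apply/eqP; rewrite -normr_le0 cplx_normE -[0]/((0 : R)%:C) lecR -f0.
exact: sup_norm_ge.
Qed.

Lemma AD_normZ (a : C) (f : AD) : AD_norm (a *: f) = `|a| * AD_norm f.
Proof.
apply/eqP; rewrite eq_le AD_normZ_le /=.
have [->|a0] := eqVneq a 0.
  by rewrite normr0 mul0r -[0]/((0 : R)%:C) lecR sup_norm_ge0.
rewrite -[in leLHS](scalerK a0 f) -ler_pdivlMl ?normr_gt0// -normfV.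
exact: AD_normZ_le.
Qed.

HB.instance Definition _ :=
  Lmodule_isNormed.Build C AD AD_normD AD_normZ AD_norm0_eq0.

(* [volterra g f] is T_g(f). The antiderivative exists by Cauchy's theorem and
   is unique; [xget] selects it, its default value 0 being never used. *)
Definition volterra (g f : HD) : HD :=
  xget 0 [set F : HD | (forall z : C, disc z ->
    is_derive z 1 F (f z * derive1 g z)) /\ F 0 = 0].

Definition Y1 (g : HD) : set HD :=
  [set f | f \in disc_algebra /\ ~ Hinf (volterra g f)].

Definition Y3 (g : HD) : set HD :=
  [set f | Hinf f /\ ~ Hinf (volterra g f)].

End Disc.

Arguments HD : clear implicits.
Arguments AD : clear implicits.

(* Main.v *)
Require Import Defs.
From mathcomp Require Import all_boot all_order all_algebra.
From mathcomp Require Import complex ring lra.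
From mathcomp Require Import all_classical all_reals.
From mathcomp Require Import topology normedtype.
From mathcomp Require Import sequences derive realfun exp trigo.

(* Write L(z) = 2 - log(1 - z), whose real part is at least 1 on the closed disc
   minus 1 and whose imaginary part is bounded. The functions
   f0 = exp(-iL)/sqrt L and g0 = exp(iL)/sqrt L extend continuously by 0 to
   z = 1, while f0 g0' is the derivative of i log L + 1/(2L), which is
   unbounded. Since T is linear in g, for every g
   and every t <> 0 one of T_g(f0), T_(g + t g0)(f0) is unbounded, and
   g + t g0 -> g as t -> 0 in both topologies.

   That T_g(f0) exists for an arbitrary g follows from integration by parts:
   f0 g' = (f0 g)' - f0' g, and f0' g is complex differentiable, hence has a
   primitive by Goursat's theorem. Path integrals are replaced by limits of
   midpoint sums over dyadic subdivisions of segments. These are exact on affine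
   functions, so bisection yields both their convergence and the vanishing of
   their limit around triangles. *)

Set Implicit Arguments.
Unset Strict Implicit.
Unset Printing Implicit Defensive.

Import Order.TTheory GRing.Theory Num.Theory numFieldNormedType.Exports.
Local Open Scope classical_set_scope.
Local Open Scope complex_scope.
Local Open Scope ring_scope.

(** * Complex differentiability with a real-valued modulus *)

(** Clearing the denominator of the difference quotient removes the puncture at [z]. The field is
    general so that the criterion serves both complex functions and the real [expR], [cos] and
    [sin]. *)
Lemma is_derive_nearP (K : numFieldType) (f : K -> K) (z d : K) :
  is_derive z 1 f d <->
  forall e, 0 < e -> \forall w \near z, `|f w - f z - d * (w - z)| <= e * `|w - z|.
Proof.
pose q h := h^-1 *: ((f \o shift z) (h *: 1) - f z).
have qE w : w != z -> `|q (w - z) - d| = `|f w - f z - d * (w - z)| / `|w - z|.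
  move=> wz; have wz0 : w - z != 0 by rewrite subr_eq0.
  rewrite -normfV -normrM; congr `|_|.
  by rewrite /q /= [(w - z) *: 1]mulr1 subrK -[_ *: _]/(_ * _); field.
have qP : q @ 0^' --> d <->
    forall e, 0 < e -> \forall w \near z, `|f w - f z - d * (w - z)| <= e * `|w - z|.
  split=> [/cvgrPdist_le qd e /qd[r /= r0 zr]|df].
    exists r => //= w wz.
    have [->|wNz] := eqVneq w z; first by rewrite !subrr mulr0 subr0 normr0 mulr0.
    have wz0 : w - z != 0 by rewrite subr_eq0.
    have : `|d - q (w - z)| <= e by apply: zr => //=; rewrite sub0r normrN distrC.
    by rewrite distrC qE// ler_pdivrMr ?normr_gt0.
  apply/cvgrPdist_le => e /df[r /= r0 zr]; exists r => // h /=.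
  rewrite sub0r normrN -(addrK z h); move: (h + z) => w wr; rewrite subr_eq0 => wz.
  rewrite -/(q (w - z)) distrC qE// ler_pdivrMr ?normr_gt0 ?subr_eq0//.
  by apply: zr; rewrite /= distrC.
rewrite -qP; split=> [[dfz <-]|qd]; first exact: dfz.
by split; [apply: cvgP; exact: qd|exact: cvg_lim qd].
Qed.

Section Modulus.
Variable R : realType.
Local Notation C := (cplx R).
Implicit Types (a b c d z w : C) (x y e : R).

(* [`|z|] is an element of [C], whose order is partial; [nrm z] is its value
   in [R]. *)
Definition nrm (z : C) : R := complex.Re `|z|.

Lemma nrmE z : `|z| = (nrm z)%:C.
Proof. exact: cplx_normE. Qed.

Lemma nrm_sqrt z :
  nrm z = Num.sqrt (complex.Re z ^+ 2 + complex.Im z ^+ 2).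
Proof. by rewrite /nrm normc_def. Qed.

Lemma nrm_ge0 z : 0 <= nrm z.
Proof. by rewrite nrm_sqrt sqrtr_ge0. Qed.

Lemma nrmD z w : nrm (z + w) <= nrm z + nrm w.
Proof. by rewrite -lecR rmorphD /= -!nrmE ler_normD. Qed.

Lemma nrmN z : nrm (- z) = nrm z.
Proof. by rewrite /nrm normrN. Qed.

Lemma nrmB z w : nrm (z - w) <= nrm z + nrm w.
Proof. by rewrite -(nrmN w) nrmD. Qed.

Lemma nrm_dist z w : nrm (z - w) = nrm (w - z).
Proof. by rewrite -nrmN opprB. Qed.

Lemma nrm_tri c z w : nrm (z - w) <= nrm (z - c) + nrm (c - w).
Proof. by rewrite -{1}(subrK c z) -addrA nrmD. Qed.

Lemma nrmM z w : nrm (z * w) = nrm z * nrm w.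
Proof. by apply: (@complexI R); rewrite rmorphM /= -!nrmE normrM. Qed.

Lemma nrmV z : nrm z^-1 = (nrm z)^-1.
Proof. by apply: (@complexI R); rewrite fmorphV /= -!nrmE normfV. Qed.

Lemma nrm0 : nrm 0 = 0.
Proof. by rewrite /nrm normr0. Qed.

Lemma nrm1 : nrm 1 = 1.
Proof. by rewrite /nrm normr1. Qed.

Lemma nrm_eq0 z : (nrm z == 0) = (z == 0).
Proof. by rewrite -(inj_eq (@complexI R)) -nrmE normr_eq0. Qed.

Lemma nrm_gt0 z : (0 < nrm z) = (z != 0).
Proof. by rewrite -ltcR -nrmE normr_gt0. Qed.

Lemma nrm_real x : nrm x%:C = `|x|.
Proof. by rewrite nrm_sqrt /= expr0n addr0 sqrtr_sqr. Qed.

Lemma nrm_i : nrm 'i = 1.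
Proof. by rewrite nrm_sqrt /= expr0n expr1n add0r sqrtr1. Qed.

Lemma nrm2 : nrm 2 = 2.
Proof. by rewrite -[2 in LHS](rmorph_nat (real_complex R) 2) nrm_real ger0_norm. Qed.

Lemma nrm_half z : nrm (z / 2) = nrm z / 2.
Proof. by rewrite nrmM nrmV nrm2. Qed.

Lemma Re_le_nrm z : `|complex.Re z| <= nrm z.
Proof. by rewrite -lecR -nrmE; case: (Re_norm_le z). Qed.

Lemma Im_le_nrm z : `|complex.Im z| <= nrm z.
Proof. by rewrite -lecR -nrmE; case: (Re_norm_le z). Qed.

Lemma nrm_le_ReIm z : nrm z <= `|complex.Re z| + `|complex.Im z|.
Proof.
rewrite [z in leLHS]complexE; apply: le_trans (nrmD _ _) _.
by rewrite nrmM nrm_i mul1r !nrm_real.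
Qed.

Lemma discE z : disc z = (nrm z < 1) :> Prop.
Proof. by rewrite /disc /= nrmE -ltcR. Qed.

Lemma cdiscE z : cdisc z = (nrm z <= 1) :> Prop.
Proof. by rewrite /cdisc /= nrmE -lecR. Qed.

Lemma nbhs_nrmP z (A : set C) :
  nbhs z A <-> exists2 e : R, 0 < e & forall w, nrm (w - z) < e -> A w.
Proof.
split=> [/(@nbhs_ballP C C z)[e /= e0 zeA]|[e e0 zeA]].
  have eE : e = (complex.Re e)%:C by rewrite RRe_real// gtr0_real.
  exists (complex.Re e) => [|w we]; first by rewrite -ltcR -eE.
  by apply: zeA; rewrite -ball_normE /= distrC nrmE eE ltcR.
apply/(@nbhs_ballP C C z); exists e%:C => /=; first by rewrite ltcR.
by move=> w; rewrite -ball_normE /= distrC nrmE ltcR; exact: zeA.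
Qed.

Lemma cvg_nrmP (T : Type) (F : set_system T) (FF : Filter F) (f : T -> C) z :
  f @ F --> z <-> forall e, 0 < e -> \forall t \near F, nrm (f t - z) < e.
Proof.
split=> [fz e e0|fz A /nbhs_nrmP[e e0 zeA]].
  by apply: (fz [set w | nrm (w - z) < e]); apply/nbhs_nrmP; exists e.
by apply: filterS (fz _ e0) => t; exact: zeA.
Qed.

Lemma is_derive_nrmP (f : C -> C) z d : is_derive z 1 f d <->
  forall e, 0 < e -> exists2 r, 0 < r &
    forall w, nrm (w - z) < r -> nrm (f w - f z - d * (w - z)) <= e * nrm (w - z).
Proof.
split=> [/is_derive_nearP df e e0|df].
  have e0' : (0 : C) < e%:C by rewrite ltcR.
  have /nbhs_nrmP[r r0 zr] := df _ e0'; exists r => // w /zr.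
  by rewrite !nrmE -rmorphM lecR.
apply/is_derive_nearP => e e0.
have eE : e = (complex.Re e)%:C by rewrite RRe_real// gtr0_real.
have [|r r0 zr] := df (complex.Re e); first by rewrite -ltcR -eE.
apply/nbhs_nrmP; exists r => // w /zr.
by rewrite !nrmE eE -rmorphM lecR.
Qed.

Lemma is_derive_comp (f g : C -> C) z df dg :
  is_derive (g z) 1 f df -> is_derive z 1 g dg ->
  is_derive z 1 (f \o g) (df * dg).
Proof.
move=> /is_derive_nrmP fz /is_derive_nrmP gz; apply/is_derive_nrmP => e e0.
(* [K] is a local Lipschitz constant of [g] at [z]; [M] dominates [nrm df] and stays positive when
   [df] vanishes. *)
pose K := nrm dg + 1; pose M := nrm df + 1.
have K0 : 0 < K by rewrite ltr_wpDl// nrm_ge0.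
have M0 : 0 < M by rewrite ltr_wpDl// nrm_ge0.
have [r r0 fr] := fz _ (divr_gt0 (divr_gt0 e0 K0) (@ltr0Sn R 1)).
have [s s0 gs] := gz _ ltr01.
have [t t0 gt] := gz _ (divr_gt0 (divr_gt0 e0 M0) (@ltr0Sn R 1)).
exists (Num.min s (Num.min t (r / K))) => [|w].
  by rewrite !lt_min s0 t0 divr_gt0.
rewrite !lt_min => /and3P[ws wt wr].
have gK : nrm (g w - g z) <= K * nrm (w - z).
  rewrite -(subrK (dg * (w - z)) (g w - g z)); apply: le_trans (nrmD _ _) _.
  by rewrite nrmM mulrDl addrC lerD2l; exact: gs.
have := fr (g w); rewrite ltr_pdivlMr// mulrC in wr.
move=> /(_ (le_lt_trans gK wr)) h1.
have h2 := gt _ wt.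
have -> : (f \o g) w - (f \o g) z - df * dg * (w - z) =
   (f (g w) - f (g z) - df * (g w - g z)) + df * (g w - g z - dg * (w - z)).
  by rewrite /=; ring.
apply: le_trans (nrmD _ _) _; rewrite nrmM.
have h3 : e / K / 2 * nrm (g w - g z) <= e / 2 * nrm (w - z).
  apply: (@le_trans _ _ (e / K / 2 * (K * nrm (w - z)))).
    by apply: ler_wpM2l => //; rewrite !divr_ge0// ltW.
  by rewrite le_eqVlt; apply/orP; left; apply/eqP; field; rewrite gt_eqF.
have h4 : nrm df * nrm (g w - g z - dg * (w - z)) <= e / 2 * nrm (w - z).
  apply: (@le_trans _ _ (M * (e / M / 2 * nrm (w - z)))).
    by apply: ler_pM; rewrite ?nrm_ge0// lerDl.
  by rewrite le_eqVlt; apply/orP; left; apply/eqP; field; rewrite gt_eqF.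
lra.
Qed.

Lemma is_derive_near (f g : C -> C) z d :
  (\forall w \near z, f w = g w) -> is_derive z 1 f d -> is_derive z 1 g d.
Proof.
move=> fg /is_derive_nrmP fz; apply/is_derive_nrmP => e /fz[r r0 fr].
have /nbhs_nrmP[s s0 fgs] := fg; exists (Num.min r s); first by rewrite lt_min r0.
move=> w; rewrite lt_min => /andP[wr ws].
by rewrite -fgs// -fgs; [exact: fr|rewrite subrr nrm0].
Qed.

Lemma disc_near z : disc z -> \forall w \near z, disc w.
Proof.
rewrite discE => z1; apply/nbhs_nrmP; exists (1 - nrm z); first by rewrite subr_gt0.
move=> w wz; rewrite discE; have := nrm_tri 0 w 0; rewrite !subr0 => _.
have := nrmD (w - z) z; rewrite subrK; lra.
Qed.

End Modulus.

(** * Goursat's theorem *)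

Section Goursat.
Variable R : realType.
Local Notation C := (cplx R).
Local Notation nrm := (@nrm R).
Implicit Types (a b c d z w : C) (x y e : R) (h : C -> C).

(** Compactness of the closed unit disc. A radius [r < 1] keeps the cluster point in the open disc,
    where differentiability is available. *)
Lemma cdisc_cluster (u : nat -> C) r : r <= 1 -> (forall n, nrm (u n) <= r) ->
  exists2 z, nrm z <= r & forall e, 0 < e ->
    forall N, exists2 n, (N <= n)%N & nrm (u n - z) < e.
Proof.
move=> r1 ur; have [|z [_ uz]] := @cdisc_compact R (u @ \oo) _.
  by exists 0%N => // n _ /=; rewrite cdiscE (le_trans (ur n)).
have zu e : 0 < e -> forall N, exists2 n, (N <= n)%N & nrm (u n - z) < e.
  move=> e0 N.
  have uN : (u @ \oo) (u @` [set n | (N <= n)%N]) by exists N => // n /= Nn; exists n.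
  have ze : nbhs z [set w | nrm (w - z) < e] by apply/nbhs_nrmP; exists e.
  by have [_ [[n Nn <-] une]] := uz _ _ uN ze; exists n.
exists z => //; rewrite leNgt; apply/negP => rz.
have [|n _] := zu (nrm z - r) _ 0%N; first by rewrite subr_gt0.
have := nrmD (z - u n) (u n); rewrite subrK nrm_dist; have := ur n; lra.
Qed.

Lemma halving_lt x e : 0 < e -> exists n, x / 2 ^+ n < e.
Proof.
move=> e0; exists (Num.bound `|x / e|).
rewrite ltr_pdivrMr ?exprn_gt0// mulrC -ltr_pdivrMr//.
apply: le_lt_trans (ler_norm _) _.
apply: (lt_trans (archi_boundP (normr_ge0 _))).
by rewrite -natrX ltr_nat ltn_expl.
Qed.

(* Nested bisection: [p t] is a base point and [s t] the size of the figure [t];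
   [P] is a property that some half-size part of a figure inherits. *)
Lemma bisection (T : Type) (P : T -> Prop) (p : T -> C) (s : T -> R) r :
  r <= 1 -> (forall t, P t -> nrm (p t) <= r) ->
  (forall t, P t -> exists t', [/\ P t', s t' = s t / 2 & nrm (p t' - p t) <= s t]) ->
  forall t0, P t0 -> exists2 z, nrm z <= r &
    forall e, 0 < e -> exists t, [/\ P t, s t < e & nrm (p t - z) <= 2 * s t].
Proof.
move=> r1 Pr Ps t0 Pt0.
have [f fP] : {f : T -> T & forall t, P t ->
    [/\ P (f t), s (f t) = s t / 2 & nrm (p (f t) - p t) <= s t]}.
  apply: (@choice _ _ (fun t t' => P t ->
    [/\ P t', s t' = s t / 2 & nrm (p t' - p t) <= s t])) => t.
  have [/Ps[t' Pt']|nPt] := pselect (P t); first by exists t'.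
  by exists t.
pose u n := iter n f t0.
have Pu n : P (u n) by elim: n => //= n /fP[].
have su n : s (u n) = s t0 / 2 ^+ n.
  elim: n => [|n IH]; first by rewrite expr0 divr1.
  by have [_ /= -> _] := fP _ (Pu n); rewrite IH exprSr invfM mulrA.
have s0 n : 0 <= s (u n) by have [_ _] := fP _ (Pu n); apply: le_trans; exact: nrm_ge0.
(* The bound telescopes: each step moves the base point by at most [s], which is
   [2 * s - 2 * (s / 2)]. *)
have pu n k : nrm (p (u (k + n)%N) - p (u n)) <= 2 * s (u n) - 2 * s (u (k + n)%N).
  elim: k => [|k IH]; first by rewrite add0n !subrr nrm0.
  have [_ /= sE pE] := fP _ (Pu (k + n)%N).
  have := nrm_tri (p (u (k + n)%N)) (p (u (k.+1 + n)%N)) (p (u n)).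
  by move: IH pE; rewrite addSn /= sE; lra.
have [z zr uz] := cdisc_cluster r1 (fun n => Pr _ (Pu n)).
exists z => // e e0; have [n ne] := halving_lt (s t0) e0.
exists (u n); split => //; first (by rewrite su); apply/ler_addgt0Pr => e' e'0.
have [m nm mz] := uz _ e'0 n; have := pu n (m - n)%N; rewrite subnK// => pm.
have := nrm_tri (p (u m)) (p (u n)) z; rewrite (nrm_dist (p (u n)) (p (u m))).
have := s0 m; lra.
Qed.

(** From some index on the terms lie within 1 of a fixed one, so the translated sequence has a
    cluster point in the closed unit disc; a Cauchy sequence converges to its cluster point. *)
Lemma nrm_cauchy (u : nat -> C) :
  (forall e, 0 < e -> exists N, forall m n, (N <= m)%N -> (N <= n)%N ->
    nrm (u m - u n) <= e) ->
  exists l, forall e, 0 < e -> exists N, forall n, (N <= n)%N -> nrm (u n - l) <= e.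
Proof.
move=> uc; have [N0 uN0] := uc _ ltr01.
have [|z _ uz] := @cdisc_cluster (fun n => u (N0 + n)%N - u N0) 1 (lexx _).
  by move=> n; apply: uN0; rewrite ?leq_addr.
exists (u N0 + z) => e e0; have e20 : 0 < e / 2 by rewrite divr_gt0.
have [N uN] := uc _ e20; exists N => n Nn.
have [m Nm mz] := uz _ e20 N.
have := uN n (N0 + m)%N Nn (leq_trans Nm (leq_addl _ _)).
have := nrm_tri (u (N0 + m)%N) (u n) (u N0 + z).
rewrite -addrA -opprD in mz; lra.
Qed.

(** * Midpoint sums along segments *)

(** The midpoint rule for the integral of [h] from [a] to [b] over [2 ^ n] equal pieces; the
    recursion makes one bisection of the segment cost one level. *)
Fixpoint midsum h n a b : C :=
  if n is m.+1 then midsum h m a ((a + b) / 2) + midsum h m ((a + b) / 2) b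
  else h ((a + b) / 2) * (b - a).

Lemma midsum_sym h n a b : midsum h n b a = - midsum h n a b.
Proof.
elim: n a b => [|n IH] a b /=; first by rewrite [b + a]addrC -mulrN opprB.
by rewrite [b + a]addrC opprD [RHS]addrC -!IH.
Qed.

Lemma midpointBl a b : (a + b) / 2 - a = (b - a) / 2.
Proof. by field. Qed.

Lemma midpointBr a b : b - (a + b) / 2 = (b - a) / 2.
Proof. by field. Qed.

(* The midpoint rule is exact for affine functions. *)
Lemma midsum_affine (D : set C) h c d e :
  (forall a b, D a -> D b -> D ((a + b) / 2)) ->
  (forall z, D z -> nrm (h z - (c + d * z)) <= e) ->
  forall n a b, D a -> D b ->
  nrm (midsum h n a b - (c * (b - a) + d * (b ^+ 2 - a ^+ 2) / 2)) <= e * nrm (b - a).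
Proof.
move=> Dm De; elim=> [|n IH] a b Da Db /=.
  rewrite (_ : _ - _ = (h ((a + b) / 2) - (c + d * ((a + b) / 2))) * (b - a)); last by field.
  by rewrite nrmM ler_wpM2r ?nrm_ge0//; apply: De; exact: Dm.
set m := (a + b) / 2; have Dab : D m by exact: Dm.
have := IH _ _ Da Dab; have := IH _ _ Dab Db.
rewrite midpointBl midpointBr nrm_half => h1 h2.
rewrite (_ : _ - _ =
  (midsum h n a m - (c * ((b - a) / 2) + d * (m ^+ 2 - a ^+ 2) / 2)) +
  (midsum h n m b - (c * ((b - a) / 2) + d * (b ^+ 2 - m ^+ 2) / 2))); last by field.
by apply: le_trans (nrmD _ _) _; lra.
Qed.

Lemma ball_mid z r a b : nrm (a - z) <= r -> nrm (b - z) <= r ->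
  nrm ((a + b) / 2 - z) <= r.
Proof.
move=> az bz; rewrite (_ : _ - _ = ((a - z) + (b - z)) / 2); last by field.
by rewrite nrm_half; have := nrmD (a - z) (b - z); lra.
Qed.

Lemma derivable_nrm h z e : derivable h z 1 -> 0 < e ->
  exists2 r, 0 < r & forall w, nrm (w - z) <= r -> nrm (h w - h z) <= e.
Proof.
move=> /derivable1_diffP/differentiable_continuous/cvg_nrmP hz /hz /nbhs_nrmP[r r0 zr].
exists (r / 2) => [|w wr]; first by rewrite divr_gt0.
by apply/ltW/zr; lra.
Qed.

Lemma midsum_cst h z r e n a b :
  (forall w, nrm (w - z) <= r -> nrm (h w - h z) <= e) ->
  nrm (a - z) <= r -> nrm (b - z) <= r ->
  nrm (midsum h n a b - h z * (b - a)) <= e * nrm (b - a).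
Proof.
move=> hz az bz.
have := @midsum_affine [set w | nrm (w - z) <= r] h (h z) 0 e _ _ n a b az bz.
rewrite !mul0r addr0; apply; first by move=> ? ?; exact: ball_mid.
by move=> w /= /hz; rewrite mul0r addr0.
Qed.

(** Cousin's lemma for segments: if [G] failed on a segment it would fail on one of its halves, and
    failing segments would shrink to a point of the disc, against the local hypothesis. The factor 2
    is the one that [bisection] supplies. *)
Lemma segment_cousin (G : C -> C -> Prop) :
  (forall a b, G a ((a + b) / 2) -> G ((a + b) / 2) b -> G a b) ->
  (forall z, disc z -> exists2 r, 0 < r & forall a b,
     nrm (a - z) <= 2 * nrm (b - a) -> nrm (b - a) < r -> G a b) ->
  forall a b, disc a -> disc b -> G a b.
Proof.
move=> Gm Gz a b; rewrite !discE => a1 b1; apply: contrapT => nGab.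
pose r := Num.max (nrm a) (nrm b); have r1 : r < 1 by rewrite gt_max a1 b1.
pose P (t : C * C) := [/\ nrm t.1 <= r, nrm t.2 <= r & ~ G t.1 t.2].
have [||||z zr zP] := @bisection _ P fst (fun t => nrm (t.2 - t.1)) r _ _ _ (a, b).
- exact: ltW.
- by move=> t [].
- move=> [c d] [/= cr dr nG].
  have mr : nrm ((c + d) / 2) <= r by rewrite -[_ / 2]subr0 ball_mid ?subr0.
  have [Gl|nGl] := pselect (G c ((c + d) / 2)); last first.
    exists (c, (c + d) / 2); split => //=; first by rewrite midpointBl nrm_half.
    by rewrite subrr nrm0 nrm_ge0.
  exists ((c + d) / 2, d); split => //=; first by split => //= Gr; exact/nG/Gm.
    by rewrite midpointBr nrm_half.
  by rewrite midpointBl nrm_half; have := nrm_ge0 (d - c); lra.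
- by split => //=; rewrite le_max lexx ?orbT.
have [|d d0 Gd] := Gz z; first by rewrite discE (le_lt_trans zr).
by have [[c c'] [[/= _ _ nG] cd cz]] := zP _ d0; exact/nG/Gd.
Qed.

(** On a short segment near [z] every midpoint sum is close to [h z * (b - a)], by continuity. The
    error is proportional to the length, so it adds up correctly when two halves are joined. *)
Lemma midsum_cauchy h : (forall z, disc z -> derivable h z 1) ->
  forall a b, disc a -> disc b -> forall e, 0 < e ->
  exists N, forall m n, (N <= m)%N -> (N <= n)%N ->
    nrm (midsum h m a b - midsum h n a b) <= e * nrm (b - a).
Proof.
move=> hd a b Da Db e e0; move: a b Da Db; apply: segment_cousin => [a b|z Dz].
  (* The successor pays for the level spent on joining the halves. *)
  move=> [N1 h1] [N2 h2]; exists (maxn N1 N2).+1 => -[//|m] [//|n].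
  rewrite !ltnS !geq_max => /andP[m1 m2] /andP[n1 n2] /=.
  have := h1 _ _ m1 n1; have := h2 _ _ m2 n2.
  rewrite midpointBl midpointBr nrm_half opprD addrACA => {}h2 {}h1.
  by apply: le_trans (nrmD _ _) _; lra.
have e20 : 0 < e / 2 by rewrite divr_gt0.
have [r r0 hz] := derivable_nrm (hd z Dz) e20.
exists (r / 3) => [|a b az ab]; first by rewrite divr_gt0.
have ar : nrm (a - z) <= r by lra.
have br : nrm (b - z) <= r by have := nrm_tri a b z; lra.
exists 0%N => m n _ _; have := midsum_cst m hz ar br; have := midsum_cst n hz ar br.
have := nrm_tri (h z * (b - a)) (midsum h m a b) (midsum h n a b).
by rewrite (nrm_dist (h z * (b - a))); lra.
Qed.

(** The increment bound [e * nrm (b - a)] is additive under bisection and holds locally because the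
    derivative vanishes. *)
Lemma derive0_cst h : (forall z, disc z -> is_derive z 1 h 0) ->
  forall z, disc z -> h z = h 0.
Proof.
move=> hd z Dz; apply/eqP; rewrite -subr_eq0 -nrm_eq0 eq_le nrm_ge0 andbT.
suff hle e : 0 < e -> nrm (h z - h 0) <= e * nrm (z - 0).
  apply/ler_addgt0Pr => e e0; rewrite add0r; apply: le_trans (hle _ e0) _.
  by rewrite ger_pMr// subr0; move: Dz; rewrite discE => /ltW.
move=> e0; move: (disc0 R) Dz; move: 0 z.
apply: segment_cousin => [a b|z Dz].
  rewrite midpointBl midpointBr nrm_half => h1 h2.
  by have := nrm_tri (h ((a + b) / 2)) (h b) (h a); lra.
(* The endpoints are within 2 and 3 times [nrm (b - a)] of [z], whence the divisor 5. *)
have [|r r0 hr] := (is_derive_nrmP _ _ _).1 (hd z Dz) (e / 5); first by rewrite divr_gt0.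
exists (r / 3) => [|a b az ab]; first by rewrite divr_gt0.
have bz := nrm_tri a b z; have an := nrm_ge0 (a - z).
have hA : nrm (h a - h z) <= e / 5 * nrm (a - z).
  by have := hr a; rewrite mul0r subr0; apply; lra.
have hB : nrm (h b - h z) <= e / 5 * nrm (b - z).
  by have := hr b; rewrite mul0r subr0; apply; lra.
have := nrm_tri (h z) (h b) (h a); rewrite (nrm_dist (h z)).
have : e / 5 * nrm (a - z) + e / 5 * nrm (b - z) <= e * nrm (b - a).
  have := ler_wpM2l (ltW e0) az; have := ler_wpM2l (ltW e0) bz; lra.
lra.
Qed.

(** * Midpoint sums around triangles *)

Definition triangle_sum h n (t : C * C * C) : C :=
  midsum h n t.1.1 t.1.2 + midsum h n t.1.2 t.2 + midsum h n t.2 t.1.1.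

Definition perimeter (t : C * C * C) : R :=
  nrm (t.1.2 - t.1.1) + nrm (t.2 - t.1.2) + nrm (t.1.1 - t.2).

Lemma perimeter_ge0 t : 0 <= perimeter t.
Proof. by rewrite /perimeter !addr_ge0 ?nrm_ge0. Qed.

(** The exact integrals of the affine approximation of [h] at [z] cancel around the triangle. What
    remains is an error of at most [3 * e * perimeter t], multiplied by the total length of the
    sides. *)
Lemma triangle_sum_local h z d (e r : R) : 0 < e ->
  (forall w, nrm (w - z) < r -> nrm (h w - h z - d * (w - z)) <= e * nrm (w - z)) ->
  forall n t, nrm (t.1.1 - z) <= 2 * perimeter t -> 3 * perimeter t < r ->
  nrm (triangle_sum h n t) <= 3 * e * perimeter t ^+ 2.
Proof.
move=> e0 hr n [[a b] c] /=; set s := perimeter _ => az sr.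
have s0 : 0 <= s by exact: perimeter_ge0.
have sE : s = nrm (b - a) + nrm (c - b) + nrm (a - c) by [].
have bz : nrm (b - z) <= 3 * s.
  by have := nrm_tri a b z; have := nrm_ge0 (c - b); have := nrm_ge0 (a - c); lra.
have cz : nrm (c - z) <= 3 * s.
  have := nrm_tri a c z; rewrite (nrm_dist c a).
  by have := nrm_ge0 (b - a); have := nrm_ge0 (c - b); lra.
have {}az : nrm (a - z) <= 3 * s by lra.
have hD w : nrm (w - z) <= 3 * s -> nrm (h w - (h z - d * z + d * w)) <= e * (3 * s).
  move=> wz; rewrite (_ : _ - _ = h w - h z - d * (w - z)); last by ring.
  by apply: le_trans (hr w _) _; [exact: le_lt_trans sr|rewrite ler_pM2l].
have aff := @midsum_affine [set w | nrm (w - z) <= 3 * s] h (h z - d * z) d _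
  (fun a b => @ball_mid z _ a b) hD n.
have := aff _ _ az bz; have := aff _ _ bz cz; have := aff _ _ cz az.
move: (h z - d * z) => k; rewrite /triangle_sum /= => h1 h2 h3.
rewrite (_ : _ + _ + _ =
  midsum h n a b - (k * (b - a) + d * (b ^+ 2 - a ^+ 2) / 2) +
  (midsum h n b c - (k * (c - b) + d * (c ^+ 2 - b ^+ 2) / 2)) +
  (midsum h n c a - (k * (a - c) + d * (a ^+ 2 - c ^+ 2) / 2))); last by field.
apply: le_trans (nrmD _ _) _.
rewrite (_ : 3 * e * s ^+ 2 = e * (3 * s) * nrm (b - a) +
  e * (3 * s) * nrm (c - b) + e * (3 * s) * nrm (a - c)); last first.
  by rewrite -!mulrDr -sE; ring.
by apply: lerD => //; apply: le_trans (nrmD _ _) _; exact: lerD.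
Qed.

(** The outer edges of the four triangles make up the original sides; each inner edge is run through
    twice, in opposite directions. *)
Lemma triangle_sumS h n a b c : let p := (a + b) / 2 in let q := (b + c) / 2 in
  let s := (c + a) / 2 in
  triangle_sum h n.+1 (a, b, c) =
  triangle_sum h n (a, p, s) + triangle_sum h n (p, b, q) +
  triangle_sum h n (s, q, c) + triangle_sum h n (q, s, p).
Proof.
move=> p q s; rewrite /triangle_sum /= -/p -/q -/s.
rewrite (midsum_sym h n s p) (midsum_sym h n p q) (midsum_sym h n q s).
move: (midsum h n) => I; ring.
Qed.

Lemma perimeter_half a b c : let p := (a + b) / 2 in let q := (b + c) / 2 in
  let s := (c + a) / 2 in
  [/\ perimeter (a, p, s) = perimeter (a, b, c) / 2,
      perimeter (p, b, q) = perimeter (a, b, c) / 2,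
      perimeter (s, q, c) = perimeter (a, b, c) / 2 &
      perimeter (q, s, p) = perimeter (a, b, c) / 2].
Proof.
move=> p q s.
have pa : nrm (p - a) = nrm (b - a) / 2 by rewrite midpointBl nrm_half.
have bp : nrm (b - p) = nrm (b - a) / 2 by rewrite midpointBr nrm_half.
have qb : nrm (q - b) = nrm (c - b) / 2 by rewrite midpointBl nrm_half.
have cq : nrm (c - q) = nrm (c - b) / 2 by rewrite midpointBr nrm_half.
have sc : nrm (s - c) = nrm (a - c) / 2 by rewrite midpointBl nrm_half.
have sa : nrm (a - s) = nrm (a - c) / 2 by rewrite midpointBr nrm_half.
have sp : nrm (s - p) = nrm (c - b) / 2.
  by rewrite -nrm_half; congr nrm; rewrite /s /p; field.
have pq : nrm (p - q) = nrm (a - c) / 2.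
  by rewrite -nrm_half; congr nrm; rewrite /q /p; field.
have qs : nrm (q - s) = nrm (b - a) / 2.
  by rewrite -nrm_half; congr nrm; rewrite /s /q; field.
rewrite /perimeter /=; split; rewrite ?pa ?sp ?sa ?bp ?qb ?pq ?qs ?cq ?sc //; first by ring.
- by ring.
- by ring.
- by rewrite (nrm_dist s q) (nrm_dist p s) (nrm_dist q p) qs sp pq; ring.
Qed.

(** Goursat's argument: a bound by a multiple of the squared perimeter passes from the four
    half-size triangles to the whole, as [4 * (1 / 2) ^ 2 = 1]. A failure would thus descend to
    arbitrarily small triangles near one point, where [triangle_sum_local] excludes it. *)
Lemma goursat_triangle h : (forall z, disc z -> derivable h z 1) ->
  forall t, disc t.1.1 -> disc t.1.2 -> disc t.2 -> forall e, 0 < e ->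
  exists N, forall n, (N <= n)%N -> nrm (triangle_sum h n t) <= e.
Proof.
move=> hd t t11 t12 t2 e e0.
pose G e (t : C * C * C) := exists N, forall n, (N <= n)%N ->
   nrm (triangle_sum h n t) <= e * perimeter t ^+ 2.
(* Adding 1 allows for a degenerate triangle of perimeter 0. *)
suff : G (e / (perimeter t ^+ 2 + 1)) t.
  move=> [N GN]; exists N => n /GN /le_trans; apply.
  have p0 := sqr_ge0 (perimeter t).
  by rewrite mulrAC ler_pdivrMr ?ltr_wpDl// ler_pM2l// lerDl.
have {}e0 : 0 < e / (perimeter t ^+ 2 + 1) by rewrite divr_gt0// ltr_wpDl// sqr_ge0.
move: {e}(e / _) e0 => e e0; apply: contrapT => nG.
pose r := Num.max (nrm t.1.1) (Num.max (nrm t.1.2) (nrm t.2)).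
pose P (t : C * C * C) := [/\ nrm t.1.1 <= r, nrm t.1.2 <= r, nrm t.2 <= r & ~ G e t].
have r1 : r < 1 by rewrite !discE in t11 t12 t2; rewrite !gt_max t11 t12 t2.
have [||||z zr zP] := @bisection _ P (fun t => t.1.1) perimeter r _ _ _ t.
- exact: ltW.
- by move=> ? [].
- move=> [[a b] c] [/= ar br cr nGt].
  pose p := (a + b) / 2; pose q := (b + c) / 2; pose s := (c + a) / 2.
  have pr : nrm p <= r by rewrite -[p]subr0 ball_mid ?subr0.
  have qr : nrm q <= r by rewrite -[q]subr0 ball_mid ?subr0.
  have sr : nrm s <= r by rewrite -[s]subr0 ball_mid ?subr0.
  have [h1 h2 h3 h4] := perimeter_half a b c.
  have d1 : nrm (p - a) <= perimeter (a, b, c).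
    rewrite midpointBl nrm_half /perimeter /=.
    by have := nrm_ge0 (b - a); have := nrm_ge0 (c - b); have := nrm_ge0 (a - c); lra.
  have d2 : nrm (s - a) <= perimeter (a, b, c).
    rewrite nrm_dist midpointBr nrm_half /perimeter /=.
    by have := nrm_ge0 (b - a); have := nrm_ge0 (c - b); have := nrm_ge0 (a - c); lra.
  have d3 : nrm (q - a) <= perimeter (a, b, c).
    have := nrm_tri p q a; rewrite midpointBl nrm_half.
    rewrite (_ : q - p = (c - a) / 2); last by rewrite /q /p; field.
    rewrite nrm_half (nrm_dist c) /perimeter /=.
    by have := nrm_ge0 (b - a); have := nrm_ge0 (c - b); have := nrm_ge0 (a - c); lra.
  have [g1|n1] := pselect (G e (a, p, s)); last first.
    by exists (a, p, s); split => //=; rewrite subrr nrm0 perimeter_ge0.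
  have [g2|n2] := pselect (G e (p, b, q)); last by exists (p, b, q).
  have [g3|n3] := pselect (G e (s, q, c)); last by exists (s, q, c).
  have [g4|n4] := pselect (G e (q, s, p)); last by exists (q, s, p).
  case: nGt; case: g1 => N1 g1; case: g2 => N2 g2; case: g3 => N3 g3; case: g4 => N4 g4.
  exists (maxn (maxn N1 N2) (maxn N3 N4)).+1 => -[//|n].
  rewrite ltnS !geq_max => /andP[/andP[/g1 {}g1 /g2 {}g2] /andP[/g3 {}g3 /g4 {}g4]].
  rewrite triangle_sumS.
  move: g1 g2 g3 g4; rewrite h1 h2 h3 h4 => g1 g2 g3 g4.
  move: (triangle_sum _ _ _) g1 (triangle_sum _ _ _) g2 (triangle_sum _ _ _) g3
    (triangle_sum _ _ _) g4 => x1 g1 x2 g2 x3 g3 x4 g4.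
  have := nrmD (x1 + x2 + x3) x4; have := nrmD (x1 + x2) x3; have := nrmD x1 x2.
  rewrite expr_div_n (_ : 2 ^+ 2 = 4) in g1 g2 g3 g4; last by ring.
  lra.
- by split => //; rewrite !le_max lexx ?orbT.
have Dz : disc z by rewrite discE (le_lt_trans zr).
have e30 : 0 < e / 3 by rewrite divr_gt0.
have /derivableP dz := hd z Dz.
have [d d0 hr] := (is_derive_nrmP _ _ _).1 dz _ e30.
have d30 : 0 < d / 3 by rewrite divr_gt0.
have [t' [[_ _ _ nG'] td tz]] := zP _ d30; apply: nG'; exists 0%N => n _.
have := triangle_sum_local e30 hr n tz.
by rewrite (_ : 3 * (e / 3) = e); [apply; lra|field].
Qed.

(** [H z] is the limit of the midpoint sums from 0 to [z]. The triangle with vertices 0, [z], [w]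
    identifies [H w - H z] with the sums from [z] to [w], which continuity compares with
    [h z * (w - z)]. *)
Lemma holomorphic_primitive h : (forall z, disc z -> derivable h z 1) ->
  exists H : C -> C, forall z, disc z -> is_derive z 1 H (h z).
Proof.
move=> hd.
have [H HP] : {H : C -> C & forall z, disc z -> forall e, 0 < e ->
    exists N, forall n, (N <= n)%N -> nrm (midsum h n 0 z - H z) <= e}.
  apply: (@choice _ _ (fun z l => disc z -> forall e, 0 < e ->
    exists N, forall n, (N <= n)%N -> nrm (midsum h n 0 z - l) <= e)) => z.
  have [Dz|nDz] := pselect (disc z); last by exists 0.
  have [|l hl] := @nrm_cauchy (fun n => midsum h n 0 z); last by exists l.
  move=> e e0; have [N hN] := midsum_cauchy hd (disc0 R) Dz e0.
  exists N => m n Nm Nn; apply: le_trans (hN m n Nm Nn) _.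
  by rewrite ger_pMr// subr0; move: Dz; rewrite discE => /ltW.
exists H => z Dz; apply/is_derive_nrmP => e e0.
have [r r0 hr] := derivable_nrm (hd z Dz) e0.
have /nbhs_nrmP[s s0 zs] := disc_near Dz.
exists (Num.min r s) => [|w]; rewrite lt_min ?r0// => /andP[/ltW wr /zs Dw].
(* Two limits and one triangle sum are replaced at a common level [n], each at a cost of
   [e' / 3]. *)
apply/ler_addgt0Pr => e' e'0; have e30 : 0 < e' / 3 by rewrite divr_gt0.
have [N1 h1] := HP _ Dw _ e30; have [N2 h2] := HP _ Dz _ e30.
have [N3 h3] := @goursat_triangle h hd (0, z, w) (disc0 R) Dz Dw _ e30.
pose n := maxn N1 (maxn N2 N3).
have {}h1 : nrm (midsum h n 0 w - H w) <= e' / 3 by apply: h1; rewrite leq_max leqnn.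
have {}h2 : nrm (midsum h n 0 z - H z) <= e' / 3 by apply: h2; rewrite !leq_max leqnn orbT.
have {}h3 : nrm (triangle_sum h n (0, z, w)) <= e' / 3 by apply: h3; rewrite !leq_max leqnn !orbT.
have zz : nrm (z - z) <= r by rewrite subrr nrm0 ltW.
have h4 := midsum_cst n hr zz wr.
have -> : H w - H z - h z * (w - z) =
  midsum h n z w - h z * (w - z) - (midsum h n 0 w - H w) + (midsum h n 0 z - H z)
  - triangle_sum h n (0, z, w).
  by rewrite /triangle_sum /= (midsum_sym h n 0 w); move: (midsum h n) => I; ring.
have := nrmB (midsum h n z w - h z * (w - z) - (midsum h n 0 w - H w) +
  (midsum h n 0 z - H z)) (triangle_sum h n (0, z, w)).
have := nrmD (midsum h n z w - h z * (w - z) - (midsum h n 0 w - H w)) (midsum h n 0 z - H z).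
have := nrmB (midsum h n z w - h z * (w - z)) (midsum h n 0 w - H w).
lra.
Qed.

End Goursat.

(** * Exponential and logarithm *)

Section ExpLog.
Variable R : realType.
Local Notation C := (cplx R).
Local Notation nrm := (@nrm R).
Implicit Types (a b c d z w : C) (x y e : R).

Definition cexp (z : C) : C :=
  (expR (complex.Re z) * cos (complex.Im z)) +i*
  (expR (complex.Re z) * sin (complex.Im z)).

Lemma cexpD z w : cexp (z + w) = cexp z * cexp w.
Proof.
case: z w => [a b] [c d]; apply/eqP; rewrite eq_complex /=.
by rewrite expRD cosD sinD; apply/andP; split; apply/eqP; ring.
Qed.

Lemma cexp0 : cexp 0 = 1.
Proof. by rewrite /cexp /= expR0 cos0 sin0 mulr1 mulr0. Qed.

Lemma nrm_cexp z : nrm (cexp z) = expR (complex.Re z).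
Proof.
rewrite nrm_sqrt /= !exprMn -mulrDr cos2Dsin2 mulr1 sqrtr_sqr.
by rewrite ger0_norm ?expR_ge0.
Qed.

(** The real and imaginary parts of the remainder are expressed through the first-order remainders
    at 0 of the real [expR], [cos] and [sin]. *)
Lemma is_derive_cexp0 : is_derive (0 : C) 1 cexp 1.
Proof.
apply/is_derive_nrmP => e e0.
(* The four error terms add up to at most [k * nrm w] times 1 + 2 + 4 + 1; [k <= 1] bounds the
   auxiliary factors. *)
pose k := Num.min 1 (e / 8).
have k0 : 0 < k by rewrite lt_min ltr01 divr_gt0.
have k1 : k <= 1 by rewrite ge_min lexx.
have ke : k <= e / 8 by rewrite ge_min lexx orbT.
move: k k0 k1 ke => k k0 k1 ke.
have /is_derive_nearP /(_ _ k0) [r1 /= r10 h1] := @is_derive_expR R 0.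
have /is_derive_nearP /(_ _ k0) [r2 /= r20 h2] := @is_derive_cos R 0.
have /is_derive_nearP /(_ _ k0) [r3 /= r30 h3] := @is_derive_sin R 0.
exists (Num.min k (Num.min r1 (Num.min r2 r3))).
  by rewrite !lt_min k0 r10 r20 r30.
move=> w; rewrite subr0 !lt_min cexp0 mul1r => /and4P[wk w1 w2 w3].
set x := complex.Re w; set y := complex.Im w.
have xw : `|x| <= nrm w by exact: Re_le_nrm.
have yw : `|y| <= nrm w by exact: Im_le_nrm.
have {}h1 : `|expR x - 1 - x| <= k * `|x|.
  have := h1 x; rewrite /= sub0r normrN expR0 mul1r subr0; apply.
  exact: le_lt_trans w1.
have {}h2 : `|cos y - 1| <= k * `|y|.
  have := h2 y; rewrite /= sub0r normrN subr0 cos0 sin0 oppr0 mul0r subr0; apply.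
  exact: le_lt_trans w2.
have {}h3 : `|sin y - y| <= k * `|y|.
  have := h3 y; rewrite /= sub0r normrN cos0 sin0 mul1r !subr0; apply.
  exact: le_lt_trans w3.
apply: le_trans (nrm_le_ReIm _) _.
have -> : complex.Re (cexp w - 1 - w) = (expR x - 1 - x) * cos y + (1 + x) * (cos y - 1).
  by rewrite /x /y; case: w {h1 h2 h3 xw yw wk w1 w2 w3 x y} => a b /=; ring.
have -> : complex.Im (cexp w - 1 - w) = (expR x - 1) * sin y + (sin y - y).
  by rewrite /x /y; case: w {h1 h2 h3 xw yw wk w1 w2 w3 x y} => a b /=; ring.
have A1 : `|(expR x - 1 - x) * cos y| <= k * `|x|.
  rewrite normrM -[leRHS]mulr1; apply: ler_pM => //; exact: cos_max.
have A2 : `|(1 + x) * (cos y - 1)| <= 2 * (k * `|y|).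
  rewrite normrM; apply: ler_pM => //.
  apply: le_trans (ler_normD _ _) _; rewrite normr1; lra.
have A3 : `|(expR x - 1) * sin y| <= (2 * k) * (2 * `|y|).
  rewrite normrM; apply: ler_pM => //.
    have := ler_normD (expR x - 1 - x) x; rewrite subrK.
    have : k * `|x| <= 1 * `|x| by rewrite ler_wpM2r.
    lra.
  have := ler_normD (sin y - y) y; rewrite subrK.
  have : k * `|y| <= 1 * `|y| by rewrite ler_wpM2r.
  lra.
have A4 : k * `|x| <= k * nrm w by rewrite ler_pM2l.
have A5 : k * `|y| <= k * nrm w by rewrite ler_pM2l.
have A6 : k * nrm w <= e / 8 * nrm w by rewrite ler_wpM2r ?nrm_ge0.
have := ler_normD ((expR x - 1 - x) * cos y) ((1 + x) * (cos y - 1)).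
have := ler_normD ((expR x - 1) * sin y) (sin y - y).
lra.
Qed.

Lemma is_derive_cexp z : is_derive z 1 cexp (cexp z).
Proof.
apply/is_derive_nrmP => e e0.
have z0 : 0 < nrm (cexp z) by rewrite nrm_cexp expR_gt0.
have [r r0 hr] := (is_derive_nrmP _ _ _).1 is_derive_cexp0 _ (divr_gt0 e0 z0).
exists r => // w wr; have := hr (w - z); rewrite subr0 => /(_ wr).
rewrite cexp0 mul1r => h.
have -> : cexp w - cexp z - cexp z * (w - z) = cexp z * (cexp (w - z) - 1 - (w - z)).
  by rewrite -[in cexp w](subrK z w) (cexpD (w - z)); ring.
by rewrite nrmM mulrC -ler_pdivlMr// mulrAC.
Qed.

(** Put [u = g w - g z]. Differentiability of [f] makes [w - z - d * u] small relative to [u]. This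
    first yields a Lipschitz bound on [u] in terms of [w - z], and then the derivative of [g]; the
    two terms in the minimum [k] serve these two purposes. *)
Lemma is_derive_local_inverse (f g : C -> C) z d : d != 0 -> {for z, continuous g} ->
  (\forall w \near z, f (g w) = w) -> is_derive (g z) 1 f d ->
  is_derive z 1 g d^-1.
Proof.
move=> d0 /cvg_nrmP gz /nbhs_nrmP[s s0 fg] /is_derive_nrmP fz.
apply/is_derive_nrmP => e e0; have nd0 : 0 < nrm d by rewrite nrm_gt0.
pose k := Num.min (nrm d / 2) (e * nrm d ^+ 2 / 2).
have k0 : 0 < k by rewrite lt_min !divr_gt0// mulr_gt0// exprn_gt0.
have kd : k <= nrm d / 2 by rewrite ge_min lexx.
have ke : k <= e * nrm d ^+ 2 / 2 by rewrite ge_min lexx orbT.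
move: k k0 kd ke => k k0 kd ke.
have [r r0 fr] := fz _ k0.
have /nbhs_nrmP[t t0 gt] := gz _ r0.
exists (Num.min s t) => [|w]; first by rewrite lt_min s0.
rewrite lt_min => /andP[ws /gt /fr]; rewrite !fg//; last by rewrite subrr nrm0.
move=> h.
set u := g w - g z in h *.
have u1 : nrm d * nrm u <= nrm (w - z) + k * nrm u.
  rewrite -nrmM; rewrite nrm_dist in h.
  by have := nrmD (d * u - (w - z)) (w - z); rewrite subrK; lra.
have u2 : k * nrm u <= nrm d / 2 * nrm u by rewrite ler_wpM2r ?nrm_ge0.
have u3 : nrm u <= 2 / nrm d * nrm (w - z).
  rewrite mulrAC ler_pdivlMr// mulrC; lra.
have -> : u - d^-1 * (w - z) = - (d^-1 * (w - z - d * u)) by field.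
rewrite nrmN nrmM nrmV mulrC ler_pdivrMr//; apply: le_trans h _.
apply: (@le_trans _ _ (e * nrm d ^+ 2 / 2 * (2 / nrm d * nrm (w - z)))).
  by apply: ler_pM; rewrite ?nrm_ge0// ltW.
by rewrite le_eqVlt; apply/orP; left; apply/eqP; field; rewrite gt_eqF.
Qed.

(* The principal branch; meaningful only on the right half-plane. *)
Definition clog (z : C) : C := ln (nrm z) +i* atan (complex.Im z / complex.Re z).

Lemma Re_gt0_nrm_gt0 z : 0 < complex.Re z -> 0 < nrm z.
Proof. by move=> z0; apply: lt_le_trans (Re_le_nrm z); rewrite gtr0_norm. Qed.

Lemma cexp_clogK z : 0 < complex.Re z -> cexp (clog z) = z.
Proof.
move=> z0; have zn := Re_gt0_nrm_gt0 z0; rewrite /cexp /= lnK ?posrE//.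
set x := complex.Re z in z0 *; set y := complex.Im z; set t := y / x.
have ct : cos (atan t) = x / nrm z.
  rewrite cos_atan nrm_sqrt -/x -/y.
  have -> : x ^+ 2 + y ^+ 2 = x ^+ 2 * (1 + t ^+ 2) by rewrite /t; field; rewrite gt_eqF.
  rewrite sqrtrM ?sqr_ge0// sqrtr_sqr gtr0_norm// invfM mulrA divff ?gt_eqF// mul1r//.
have ct0 : cos (atan t) != 0 by rewrite ct mulf_neq0 ?invr_eq0 ?gt_eqF.
have st : sin (atan t) = y / nrm z.
  have := atanK t; rewrite /tan => /(congr1 (fun r => r * cos (atan t))).
  by rewrite mulfVK// => ->; rewrite ct /t; field; rewrite !gt_eqF.
rewrite ct st ![nrm z * _]mulrC !mulfVK ?gt_eqF// /x /y.
by case: z {z0 zn x y t ct ct0 st}.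
Qed.

Lemma Re_continuous : continuous (fun z : C => complex.Re z).
Proof.
move=> z; have FF : Filter (nbhs z) by exact: nbhs_filter.
apply/(@cvgrPdist_lt _ _ _ _ FF) => e e0; apply/nbhs_nrmP; exists e => // w wz.
by rewrite distrC; apply: le_lt_trans wz; rewrite -raddfB; exact: Re_le_nrm.
Qed.

Lemma Im_continuous : continuous (fun z : C => complex.Im z).
Proof.
move=> z; have FF : Filter (nbhs z) by exact: nbhs_filter.
apply/(@cvgrPdist_lt _ _ _ _ FF) => e e0; apply/nbhs_nrmP; exists e => // w wz.
by rewrite distrC; apply: le_lt_trans wz; rewrite -raddfB; exact: Im_le_nrm.
Qed.

Lemma clog_continuous z : 0 < complex.Re z -> {for z, continuous clog}.
Proof.
move=> z0; have zn := Re_gt0_nrm_gt0 z0.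
have FF : Filter (nbhs z) by exact: nbhs_filter.
have lnz : (fun w : C => ln (nrm w)) @ z --> ln (nrm z).
  apply: (@continuous_comp _ _ _ nrm (@ln R)); first exact: Re_norm_continuous.
  exact: continuous_ln.
have atanz : (fun w : C => atan (complex.Im w / complex.Re w)) @ z -->
    atan (complex.Im z / complex.Re z).
  apply: (@continuous_comp _ _ _ (fun w : C => complex.Im w / complex.Re w) (@atan R)).
    apply: (@cvgM _ _ _ FF); first exact: Im_continuous.
    by apply: (@cvgV _ _ _ FF); [rewrite gt_eqF|exact: Re_continuous].
  exact: continuous_atan.
apply: (@continuous_comp _ _ _
  (fun w : C => (ln (nrm w), atan (complex.Im w / complex.Re w)))
  (fun p : R * R => Complex p.1 p.2 : C)); last exact: Complex_continuous.
exact: (cvg_pair lnz atanz).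
Qed.

Lemma Re_gt0_near z : 0 < complex.Re z -> \forall w \near z, 0 < complex.Re w.
Proof. by move=> z0; apply: (Re_continuous (lt_nbhsr z0)). Qed.

Lemma is_derive_clog z : 0 < complex.Re z -> is_derive z 1 clog z^-1.
Proof.
move=> z0; apply: (@is_derive_local_inverse cexp).
- by rewrite -nrm_gt0 Re_gt0_nrm_gt0.
- exact: clog_continuous.
- by apply: filterS (Re_gt0_near z0) => w; exact: cexp_clogK.
- by rewrite -[z in is_derive _ _ _ z]cexp_clogK//; exact: is_derive_cexp.
Qed.

(** This bounds the imaginary part of [ell], and hence the modulus of the exponentials of
    ['i * ell z] and [- 'i * ell z]. *)
Lemma Im_clog_le2 z : `|complex.Im (clog z)| <= 2.
Proof.
have := @atan_gtNpi2 R (complex.Im z / complex.Re z).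
have := @atan_ltpi2 R (complex.Im z / complex.Re z).
rewrite /= ler_norml; have := @pihalf_lt2 R; lra.
Qed.

End ExpLog.

(** * An unbounded Volterra transform *)

Section DeriveRules.
Variable R : realType.
Local Notation C := (cplx R).
Implicit Types (f g : C -> C) (z a b c : C).

Lemma is_derive_mul f g z a b : is_derive z 1 f a -> is_derive z 1 g b ->
  is_derive z 1 (fun w => f w * g w) (a * g z + f z * b).
Proof.
move=> fz gz; apply: is_derive_eq (is_deriveM fz gz) _.
by rewrite -[f z *: b]/(f z * b) -[g z *: a]/(g z * a) addrC mulrC.
Qed.

Lemma is_derive_add f g z a b : is_derive z 1 f a -> is_derive z 1 g b ->
  is_derive z 1 (fun w => f w + g w) (a + b).
Proof. by move=> fz gz; exact: (is_deriveD fz gz). Qed.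

Lemma is_derive_sub f g z a b : is_derive z 1 f a -> is_derive z 1 g b ->
  is_derive z 1 (fun w => f w - g w) (a - b).
Proof. by move=> fz gz; exact: (is_deriveB fz gz). Qed.

Lemma is_derive_const z c : is_derive z 1 (fun=> c) 0.
Proof. exact: is_derive_cst. Qed.

Lemma is_derive_scale f z a c : is_derive z 1 f a -> is_derive z 1 (fun w => c * f w) (c * a).
Proof. by move=> fz; exact: (is_deriveZ c fz). Qed.

Lemma is_derive_recip f z a : f z != 0 -> is_derive z 1 f a ->
  is_derive z 1 (fun w => (f w)^-1) (- a / f z ^+ 2).
Proof.
move=> fz0 [fz fE]; split; first exact: derivableV.
by rewrite deriveV// fE -[_ *: _]/(_ * _) mulNr mulrC mulNr.
Qed.

End DeriveRules.

Section Example.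
Variable R : realType.
Local Notation C := (cplx R).
Local Notation nrm := (@nrm R).
Implicit Types (z w : C).

Definition ell z : C := 2 - clog (1 - z).
(* [clog w / 2] gives the square root of [w]. *)
Definition ex_f z : C := cexp (- 'i * ell z - clog (ell z) / 2).
Definition ex_g z : C := cexp ('i * ell z - clog (ell z) / 2).
Definition ex_T z : C := 'i * clog (ell z) + (ell z)^-1 / 2.

Lemma Re_1B_gt0 z : cdisc z -> z != 1 -> 0 < complex.Re (1 - z).
Proof.
rewrite cdiscE => z1 zN1; rewrite raddfB /= subr_gt0 lt_neqAle.
have rz : complex.Re z <= 1 by apply: le_trans (le_trans (ler_norm _) (Re_le_nrm z)) z1.
rewrite rz andbT; apply: contra zN1 => /eqP rz1.
have : nrm z ^+ 2 <= 1 by rewrite expr_le1// nrm_ge0.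
rewrite nrm_sqrt sqr_sqrtr ?addr_ge0 ?sqr_ge0// rz1 expr1n gerDl => iz.
have : complex.Im z ^+ 2 == 0 by rewrite eq_le iz sqr_ge0.
rewrite sqrf_eq0 => /eqP iz0.
by apply/eqP; move: rz1 iz0; case: (z) => a b /= -> ->.
Qed.

Lemma Re_ell z : complex.Re (ell z) = 2 - ln (nrm (1 - z)).
Proof. by []. Qed.

(** On the closed disc [nrm (1 - z) <= 2], and [ln x <= x - 1]. So [ell] stays in the half-plane
    where [clog] is meaningful. *)
Lemma Re_ell_ge1 z : cdisc z -> z != 1 -> 1 <= complex.Re (ell z).
Proof.
move=> Dz z1; rewrite Re_ell.
have z0 : 0 < nrm (1 - z) by exact: Re_gt0_nrm_gt0 (Re_1B_gt0 Dz z1).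
suff : ln (nrm (1 - z)) <= 1 by lra.
have := @le_ln1Dx R (nrm (1 - z) - 1).
rewrite addrCA subrr addr0 => h; apply: (@le_trans _ _ (nrm (1 - z) - 1)).
  by apply: h; lra.
by move: Dz; rewrite cdiscE; have := nrmB 1 z; rewrite nrm1; lra.
Qed.

Lemma is_derive_ell z : 0 < complex.Re (1 - z) -> is_derive z 1 ell (1 - z)^-1.
Proof.
move=> z0.
have d1 : is_derive z 1 (fun w : C => 1 - w) (0 - 1).
  by apply: is_derive_sub; exact: is_derive_const.
have d2 := @is_derive_comp _ _ (fun w : C => 1 - w) _ _ _ (is_derive_clog z0) d1.
apply: is_derive_eq (is_derive_sub (is_derive_const z (2 : C)) d2) _.
by rewrite !sub0r mulrN1 opprK.
Qed.

Lemma is_derive_clog_ell z : cdisc z -> z != 1 ->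
  is_derive z 1 (fun w => clog (ell w)) ((ell z)^-1 * (1 - z)^-1).
Proof.
move=> Dz z1; apply: (is_derive_comp (is_derive_clog _) (is_derive_ell _)).
  by apply: lt_le_trans (Re_ell_ge1 Dz z1).
exact: Re_1B_gt0.
Qed.

(** The logarithmic derivative of [exp(c L) / sqrt L], where [L] is [ell]; [c = - 'i] belongs to
    [ex_f] and [c = 'i] to [ex_g]. *)
Definition ex_df (c : C) z : C := (c - (ell z)^-1 / 2) * (1 - z)^-1.

Lemma is_derive_ex (c : C) z : cdisc z -> z != 1 ->
  is_derive z 1 (fun w => cexp (c * ell w - clog (ell w) / 2))
    (cexp (c * ell z - clog (ell z) / 2) * ex_df c z).
Proof.
move=> Dz z1.
have d := is_derive_sub (is_derive_scale c (is_derive_ell (Re_1B_gt0 Dz z1)))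
  (is_derive_mul (is_derive_clog_ell Dz z1) (is_derive_const z (2^-1 : C))).
apply: is_derive_eq (is_derive_comp (is_derive_cexp _) d) _.
by rewrite /ex_df; ring.
Qed.

Lemma ell_neq0 z : cdisc z -> z != 1 -> ell z != 0.
Proof.
move=> Dz z1; rewrite -nrm_gt0 Re_gt0_nrm_gt0//.
exact: lt_le_trans (Re_ell_ge1 Dz z1).
Qed.

(** Makes the derivative of [ex_f] differentiable, as integration by parts requires. *)
Lemma derivable_ex_df c z : cdisc z -> z != 1 -> derivable (ex_df c) z 1.
Proof.
move=> Dz z1; have l0 := ell_neq0 Dz z1.
have z0 : 1 - z != 0 by rewrite subr_eq0 eq_sym.
have dl := is_derive_recip l0 (is_derive_ell (Re_1B_gt0 Dz z1)).
have d1 := is_derive_sub (is_derive_const z (1 : C)) (is_derive_id z (1 : C)).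
have dz := @is_derive_recip _ (fun w : C => 1 - w) _ _ z0 d1.
have dc := is_derive_sub (is_derive_const z c)
  (is_derive_mul dl (is_derive_const z (2^-1 : C))).
exact: (@ex_derive _ _ _ _ _ _ _ (is_derive_mul dc dz)).
Qed.

Lemma cexpN z : cexp (- z) = (cexp z)^-1.
Proof.
apply: (@mulrI _ (cexp z)); first by rewrite unitfE -nrm_gt0 nrm_cexp expR_gt0.
rewrite -cexpD subrr cexp0 divff//; by rewrite -nrm_gt0 nrm_cexp expR_gt0.
Qed.

(** The oscillating factors cancel in [ex_f * ex_g], leaving [1 / L], so the integrand is
    [('i / L - 1 / (2 L^2)) L'] with [L = ell]. *)
Lemma is_derive_ex_T z : cdisc z -> z != 1 ->
  is_derive z 1 ex_T (ex_f z * (ex_g z * ex_df 'i z)).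
Proof.
move=> Dz z1; have l0 := ell_neq0 Dz z1.
have dl := is_derive_ell (Re_1B_gt0 Dz z1).
rewrite mulrA -cexpD (_ : _ + _ = - clog (ell z)); last by field.
rewrite cexpN cexp_clogK; last exact: lt_le_trans (Re_ell_ge1 Dz z1).
apply: is_derive_eq (is_derive_add (is_derive_scale 'i (is_derive_clog_ell Dz z1))
  (is_derive_mul (is_derive_recip l0 dl) (is_derive_const z (2^-1 : C)))) _.
by rewrite /ex_df; field; rewrite subr_eq0 eq_sym z1.
Qed.

(** * Behaviour at the boundary point 1 *)

(** For imaginary [c] the real part of [c * ell z] only involves the bounded imaginary part of
    [ell z], while the factor [1 / sqrt L] tends to 0. The radius is obtained by solving
    [2 - ln (nrm (ell z)) / 2 < ln e] with the help of [2 - ln (nrm (1 - z)) <= nrm (ell z)]. *)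
Lemma ex_small_near1 (c : C) (e : R) : nrm c <= 1 -> complex.Re c = 0 -> 0 < e ->
  exists2 r : R, 0 < r & forall z, cdisc z -> z != 1 -> nrm (z - 1) < r ->
    nrm (cexp (c * ell z - clog (ell z) / 2)) < e.
Proof.
move=> c1 c0 e0; exists (expR (2 - expR (2 * (2 - ln e)))) => [|z Dz z1 zr].
  exact: expR_gt0.
have z0 : 0 < nrm (1 - z) by exact: Re_gt0_nrm_gt0 (Re_1B_gt0 Dz z1).
have l0 : 0 < nrm (ell z) by rewrite nrm_gt0 ell_neq0.
have h1 : ln (nrm (1 - z)) < 2 - expR (2 * (2 - ln e)).
  by rewrite -[ltRHS]expRK ltr_ln ?posrE ?expR_gt0// nrm_dist.
have h2 : 2 * (2 - ln e) < ln (nrm (ell z)).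
  rewrite -[ltLHS]expRK ltr_ln ?posrE ?expR_gt0//.
  apply: lt_le_trans (le_trans (ler_norm _) (Re_le_nrm (ell z))).
  by rewrite Re_ell; lra.
rewrite nrm_cexp -[ltRHS]lnK ?posrE// ltr_expR.
have Rc : complex.Re (c * ell z) <= 2.
  have := Im_clog_le2 (1 - z); have := Im_le_nrm c.
  case: c c0 c1 => c1 c2 /= -> c1' c2'; set t := atan _ => t2.
  rewrite mul0r addr0 !sub0r mulrN opprK.
  apply: le_trans (ler_norm _) _; rewrite normrM -[leRHS]mul1r.
  by apply: ler_pM => //; exact: le_trans c1'.
have -> (a b : C) : complex.Re (a - b) = complex.Re a - complex.Re b by exact: raddfB.
have -> : complex.Re (clog (ell z) / 2) = ln (nrm (ell z)) / 2.
  have -> : (2^-1 : C) = (2^-1 : R)%:C by rewrite fmorphV rmorph_nat.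
  by rewrite /clog /= mulr0 subr0.
lra.
Qed.

Lemma ex_T_unbounded (M : R) : exists2 z, disc z & M < nrm (ex_T z).
Proof.
(* With this [x] the real part of [ell z] is [expR m], so the logarithm has modulus at least [m];
   the added 1 absorbs the other term of [ex_T], of modulus at most 1/2. *)
pose m := `|M| + 1; pose x := expR (2 - expR m); pose z : C := (1 - x)%:C.
have x0 : 0 < x by exact: expR_gt0.
have m2 : 2 <= expR m.
  by apply: le_trans (expR_ge1Dx m); rewrite /m; have := normr_ge0 M; lra.
have x1 : x <= 1 by rewrite expR_le1; lra.
have Dz : disc z by rewrite discE nrm_real ger0_norm; lra.
have zE : 1 - z = x%:C by rewrite /z rmorphB /= opprB addrCA subrr addr0.
have z1 : z != 1 by rewrite -subr_eq0 -oppr_eq0 opprB zE -nrm_gt0 nrm_real gtr0_norm.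
have cDz : cdisc z by rewrite cdiscE; move: Dz; rewrite discE => /ltW.
have l1 := Re_ell_ge1 cDz z1.
have lE : complex.Re (ell z) = expR m.
  by rewrite Re_ell zE nrm_real gtr0_norm// expRK; lra.
have lm : expR m <= nrm (ell z) by rewrite -lE (le_trans (ler_norm _) (Re_le_nrm _)).
have l0 : 0 < nrm (ell z) by apply: lt_le_trans lm; exact: expR_gt0.
exists z => //.
have h1 : m <= nrm (clog (ell z)).
  apply: le_trans (le_trans (ler_norm _) (Re_le_nrm _)) => /=.
  by rewrite -[leLHS]expRK ler_ln ?posrE ?expR_gt0.
have h2 : nrm ((ell z)^-1 / 2) <= 1 / 2.
  have : (nrm (ell z))^-1 <= 1 by rewrite invf_le1//; apply: le_trans lm; lra.
  by rewrite nrm_half nrmV; lra.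
have := nrmB (ex_T z) ((ell z)^-1 / 2); rewrite addrK nrmM nrm_i mul1r.
have := ler_norm M; rewrite /m in h1; lra.
Qed.

Lemma disc_neq1 z : disc z -> z != 1.
Proof. by rewrite discE => z1; apply: contraTneq z1 => ->; rewrite nrm1 ltxx. Qed.

Lemma disc_cdisc z : disc z -> cdisc z.
Proof. by rewrite discE cdiscE => /ltW. Qed.

(** [w - v - t * ex_T] has derivative 0, hence is constant; bounds on [v] and [w] would then bound
    [ex_T]. *)
Lemma ex_T_perturbation (v w h : C -> C) t (M N : R) : t != 0 ->
  (forall z, disc z -> is_derive z 1 v (h z)) ->
  (forall z, disc z ->
    is_derive z 1 w (h z + t * (ex_f z * (ex_g z * ex_df 'i z)))) ->
  (forall z, disc z -> nrm (v z) <= M) -> (forall z, disc z -> nrm (w z) <= N) ->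
  False.
Proof.
move=> t0 dv dw vM wN; pose K z : C := w z - v z - t * ex_T z.
have dK z : disc z -> is_derive z 1 K 0.
  move=> Dz; apply: is_derive_eq (is_derive_sub (is_derive_sub (dw z Dz) (dv z Dz))
    (is_derive_scale t (is_derive_ex_T (disc_cdisc Dz) (disc_neq1 Dz)))) _.
  by ring.
have [z Dz] := ex_T_unbounded ((M + N + nrm (K 0)) / nrm t).
rewrite ltr_pdivrMr ?nrm_gt0// mulrC -nrmM.
have -> : t * ex_T z = w z - v z - K 0.
  by rewrite -(derive0_cst dK Dz) /K opprB [RHS]addrC subrK.
have := vM _ Dz; have := wN _ Dz.
have := nrmB (w z - v z) (K 0); have := nrmB (w z) (v z); lra.
Qed.

Lemma HD_extend (F : C -> C) : (forall z, disc z -> derivable F z 1) ->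
  exists f : HD R, forall z, disc z -> f z = F z.
Proof.
move=> dF; pose f z : C := if pselect (disc z) then F z else 0.
have fE z : disc z -> f z = F z by rewrite /f; case: pselect.
have f_hol : f \in @hol_disc R; last by exists (MkHD f_hol).
apply/hol_discP; split => [z Dz|z nDz]; last by rewrite /f; case: pselect.
have /derivableP dz := dF z Dz.
have [|//] := @is_derive_near _ F f z _ _ dz.
by apply: filterS (disc_near Dz) => w /fE.
Qed.

(** The continuous extension takes the value 0 at 1; elsewhere on the closed disc continuity follows
    from differentiability. *)
Lemma AD_extend (F : C -> C) :
  (forall z, cdisc z -> z != 1 -> derivable F z 1) ->
  (forall e : R, 0 < e -> exists2 r : R, 0 < r &
    forall z, cdisc z -> z != 1 -> nrm (z - 1) < r -> nrm (F z) < e) ->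
  exists f : AD R, forall z, disc z -> (f : HD R) z = F z.
Proof.
move=> dF F0; have [|f fF] := @HD_extend F.
  by move=> z Dz; apply: dF; [exact: disc_cdisc|exact: disc_neq1].
have f_AD : f \in @disc_algebra R; last by exists (MkAD f_AD).
apply/disc_algebraP; exists (fun z => if z == 1 then 0 else F z) => [|z]; last first.
  by rewrite inE => Dz; rewrite (negbTE (disc_neq1 Dz)) fF.
apply/subspace_continuousP => z Dz.
have FF : Filter (within (@cdisc R) (nbhs z)) by exact: within_filter.
apply/(cvg_nrmP FF) => e e0; rewrite nearE/=.
have [z1|z1] := eqVneq z 1.
  have [r r0 hr] := F0 _ e0; apply/nbhs_nrmP; exists r => // w wr Dw.
  rewrite /from_subspace /= z1 eqxx subr0.
  by case: (eqVneq w 1) => [_|w1]; rewrite ?nrm0//; apply: hr => //; rewrite -z1.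
have [r r0 hr] := derivable_nrm (dF z Dz z1) (divr_gt0 e0 (@ltr0Sn R 1)).
have z10 : 0 < nrm (z - 1) by rewrite nrm_gt0 subr_eq0.
(* A radius of at most [nrm (z - 1)] keeps the redefined point 1 out of the neighbourhood. *)
apply/nbhs_nrmP; exists (Num.min r (nrm (z - 1))) => [|w]; first by rewrite lt_min r0.
rewrite lt_min => /andP[/ltW/hr h wz] _.
rewrite /from_subspace /= (negbTE z1).
case: (eqVneq w 1) => [w1|w1]; last by apply: le_lt_trans h _; lra.
by rewrite w1 nrm_dist ltxx in wz.
Qed.

End Example.

(** * The Volterra operator, small perturbations and density *)

Section Volterra.
Variable R : realType.
Local Notation C := (cplx R).
Local Notation nrm := (@nrm R).
Implicit Types (z w t : C) (f g : HD R).

Lemma HinfP f : Hinf f <-> exists M : R, forall z, disc z -> nrm (f z) <= M.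
Proof.
split=> [[M [Mr MF]]|[M fM]].
  exists (complex.Re (M + 1)) => z Dz.
  have := MF (M + 1); rewrite ltrDl ltr01 => /(_ erefl z Dz) /=.
  by rewrite lecE => /andP[].
exists M%:C; split; first by rewrite complex_real.
move=> x Mx z Dz /=; apply: le_trans (ltW Mx).
by rewrite nrmE lecR fM.
Qed.

Lemma HD_is_derive g z : disc z -> is_derive z 1 g (derive1 g z).
Proof.
by case: g => g /= /hol_discP[dg _] Dz; rewrite derive1E; apply: derivableP; exact: dg.
Qed.

(* Integration by parts: the second derivative of [f] replaces that of [g],
   about which nothing is known. *)
Lemma volterra_is_derive g f (df : C -> C) :
  (forall z, disc z -> is_derive z 1 f (df z)) ->
  (forall z, disc z -> derivable df z 1) ->
  forall z, disc z -> is_derive z 1 (volterra g f) (f z * derive1 g z).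
Proof.
move=> fd dfd.
have [|H HP] := @holomorphic_primitive R (fun z => df z * g z).
  move=> z Dz; have /derivableP d1 := dfd z Dz.
  exact: (@ex_derive _ _ _ _ _ _ _ (is_derive_mul d1 (HD_is_derive g Dz))).
(* The constant normalizes [F] to vanish at 0. *)
pose F z : C := f z * g z - H z - (f 0 * g 0 - H 0).
have FP z : disc z -> is_derive z 1 F (f z * derive1 g z).
  move=> Dz; apply: is_derive_eq
    (is_derive_sub (is_derive_sub (is_derive_mul (fd z Dz) (HD_is_derive g Dz))
      (HP z Dz)) (is_derive_const z _)) _.
  by ring.
have [|G GF] := @HD_extend R F.
  by move=> z /FP[].
(* Once the set of antiderivatives is inhabited, [xget] returns one of them. *)
suff : exists W : HD R, [set F : HD R | (forall z : C, disc z ->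
    is_derive z 1 F (f z * derive1 g z)) /\ F 0 = 0] W.
  by move=> ex_W; have [] := xgetPex 0 ex_W.
exists G; split => [z Dz|]; last by rewrite GF /F ?subrr//; exact: disc0.
apply: is_derive_near (FP z Dz).
by apply: filterS (disc_near Dz) => w /GF.
Qed.

(** The two transforms differ by [t * ex_T] up to a constant. The perturbed symbol enters through a
    pointwise equation so that sums formed in [HD] and in [AD] both fit. *)
Lemma volterra_example : exists f0 g0 : AD R, forall g g1 t, t != 0 ->
  (forall z, g1 z = g z + t * (g0 : HD R) z) ->
  Hinf (volterra g f0) -> Hinf (volterra g1 f0) -> False.
Proof.
have nrmNi : nrm (- 'i) <= 1 by rewrite nrmN nrm_i.
have nrmi : nrm 'i <= 1 by rewrite nrm_i.
have [|e e0|f0 f0E] := @AD_extend R (@ex_f R).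
- by move=> z Dz z1; exact: (@ex_derive _ _ _ _ _ _ _ (is_derive_ex _ Dz z1)).
- by apply: ex_small_near1 => //=; rewrite oppr0.
have [|e e0|g0 g0E] := @AD_extend R (@ex_g R).
- by move=> z Dz z1; exact: (@ex_derive _ _ _ _ _ _ _ (is_derive_ex _ Dz z1)).
- exact: ex_small_near1.
have df0 z : disc z -> is_derive z 1 (f0 : HD R) (ex_f z * ex_df (- 'i) z).
  move=> Dz; apply: is_derive_near (is_derive_ex (- 'i) (disc_cdisc Dz) (disc_neq1 Dz)).
  by apply: filterS (disc_near Dz) => w /f0E.
have dg0 z : disc z -> is_derive z 1 (g0 : HD R) (ex_g z * ex_df 'i z).
  move=> Dz; apply: is_derive_near (is_derive_ex 'i (disc_cdisc Dz) (disc_neq1 Dz)).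
  by apply: filterS (disc_near Dz) => w /g0E.
have ddf0 z : disc z -> derivable (fun w : C => ex_f w * ex_df (- 'i) w) z 1.
  move=> Dz; have /derivableP d1 := @derivable_ex_df R (- 'i) z (disc_cdisc Dz) (disc_neq1 Dz).
  have d2 := is_derive_ex (- 'i) (disc_cdisc Dz) (disc_neq1 Dz).
  exact: (@ex_derive _ _ _ _ _ _ _ (is_derive_mul d2 d1)).
exists f0, g0 => g g1 t t0 g1E /HinfP[M1 h1] /HinfP[M2 h2].
have V := volterra_is_derive g df0 ddf0.
have W := volterra_is_derive g1 df0 ddf0.
suff W' z : disc z -> is_derive z 1 (volterra g1 f0) ((f0 : HD R) z * derive1 g z +
    t * (ex_f z * (ex_g z * ex_df 'i z))) by exact: (ex_T_perturbation t0 V W' h1 h2).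
move=> Dz; apply: is_derive_eq (W z Dz) _.
have [_ dE] := is_derive_add (HD_is_derive g Dz) (is_derive_scale t (dg0 z Dz)).
have -> : derive1 g1 z = derive1 g z + t * (ex_g z * ex_df 'i z).
  by rewrite -dE derive1E; congr ('D_1 _ z); apply/funext.
by rewrite f0E// mulrDr mulrCA.
Qed.

(** As [g0] is bounded on the disc, [t * g0] tends to 0 uniformly there, in particular on each
    compact subset. *)
Lemma HD_perturb g (g0 : HD R) (O : set (HD R)) : open O -> O g -> Hinf g0 ->
  \forall t \near (0 : C), O (g + t *: g0).
Proof.
move=> [W oW <-] Wg /HinfP[M g0M] /=.
pose G (t : C) : C -> C := fun z => g z + t * g0 z.
have FG : Filter (G @ (0 : C)) by apply: fmap_filter; exact: nbhs_filter.
have GW : {family [set K | compact K /\ K `<=` @disc R], G @ (0 : C) --> (g : C -> C)}.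
  apply/(@fam_cvgP _ _ _ _ _ FG) => K [cK KD] P /uniform_nbhs[E [+ EP]].
  rewrite -entourage_ballE => -[e /= e0 eE].
  have e0' : 0 < complex.Re e by rewrite -ltcR RRe_real// gtr0_real.
  pose m := Num.max M 0 + 1.
  have m0 : 0 < m by rewrite ltr_wpDl// le_max lexx orbT.
  apply/nbhs_nrmP; exists (complex.Re e / m) => [|t]; first by rewrite divr_gt0.
  rewrite subr0 ltr_pdivlMr// => te; apply: EP => z Kz /=; apply: eE => /=.
  rewrite -ball_normE /= /G opprD addrA subrr sub0r normrN nrmE.
  rewrite -[e]RRe_real ?gtr0_real// ltcR nrmM; apply: le_lt_trans te.
  apply: ler_wpM2l; first exact: nrm_ge0.
  apply: le_trans (g0M _ (KD _ Kz)) _.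
  by rewrite ler_wpDr// le_max lexx.
by apply: GW; exact: open_nbhs_nbhs.
Qed.

Lemma AD_perturb (g g0 : AD R) (O : set (AD R)) : open O -> O g ->
  \forall t \near (0 : C), O (g + t *: g0).
Proof.
move=> oO Og.
have [e /= e0 gO] : nbhs_ball g O by apply/nbhs_ballP; exact: open_nbhs_nbhs.
have eE : e = (complex.Re e)%:C by rewrite RRe_real// gtr0_real.
have e0' : 0 < complex.Re e by rewrite -ltcR -eE.
have m0 : 0 < sup_norm g0 + 1 by rewrite ltr_wpDl// sup_norm_ge0.
apply/nbhs_nrmP; exists (complex.Re e / (sup_norm g0 + 1)); first by rewrite divr_gt0.
move=> t; rewrite subr0 ltr_pdivlMr// => te; apply: gO.
rewrite -ball_normE /= opprD addrA subrr sub0r normrN normrZ nrmE eE.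
rewrite -[`|g0|]/((sup_norm g0)%:C) -rmorphM ltcR; apply: le_lt_trans te.
by rewrite ler_wpM2l ?nrm_ge0// lerDl.
Qed.

(** A nonempty open set contains some [x] together with [p x t] for a small nonzero [t], and one of
    the two lies in [S]. This isolates the argument common to both topologies. *)
Lemma dense_perturb (X : topologicalType) (p : X -> C -> X) (S : set X) :
  (forall x O, open O -> O x -> \forall t \near (0 : C), O (p x t)) ->
  (forall x t, t != 0 -> S x \/ S (p x t)) -> dense S.
Proof.
move=> pO Sp O [x Ox] oO; have /nbhs_nrmP[r r0 rO] := pO x O oO Ox.
have t0 : (r / 2)%:C != 0 :> C.
  by rewrite -nrm_gt0 nrm_real normr_gt0 gt_eqF// divr_gt0.
have [Sx|Spx] := Sp x _ t0; first by exists x.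
exists (p x (r / 2)%:C); split => //; apply: rO.
by rewrite subr0 nrm_real gtr0_norm ?divr_gt0//; lra.
Qed.

End Volterra.

Theorem proposition7p3 (R : realType) :
  (dense [set g : HD R | Y1 g !=set0] /\ dense [set g : HD R | Y3 g !=set0]) /\
  (dense [set g : AD R | Y1 g !=set0] /\ dense [set g : AD R | Y3 g !=set0]).
Proof.
have [f0 [g0 fg]] := volterra_example R.
(* Since [f0] lies in the disc algebra and is therefore bounded, the same function witnesses both
   sets. *)
have Y13 (g : HD R) : ~ Hinf (volterra g f0) -> Y1 g !=set0 /\ Y3 g !=set0.
  move=> ng; split; exists f0; split => //; first exact: valP.
  by apply/set_mem; exact: disc_algebra_bounded.
have Y13p (g g1 : HD R) t : t != 0 -> (forall z, g1 z = g z + t * (g0 : HD R) z) ->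
    (Y1 g !=set0 /\ Y3 g !=set0) \/ (Y1 g1 !=set0 /\ Y3 g1 !=set0).
  move=> t0 g1E; have [h|/Y13] := pselect (Hinf (volterra g f0)); last by left.
  by right; apply: Y13 => /(fg _ _ _ t0 g1E h).
have HDp (g : HD R) O : open O -> O g ->
    \forall t \near (0 : cplx R), O (g + t *: (g0 : HD R)).
  by move=> oO Og; apply: HD_perturb => //; apply/set_mem; exact: disc_algebra_bounded.
have ADp (g : AD R) O : open O -> O g ->
    \forall t \near (0 : cplx R), O (g + t *: g0).
  exact: AD_perturb.
split; split; [apply: (dense_perturb HDp)|apply: (dense_perturb HDp)|
  apply: (dense_perturb ADp)|apply: (dense_perturb ADp)] => g t t0.
- by have [[]|[]] := Y13p g (g + t *: (g0 : HD R)) t t0 (fun=> erefl); [left|right].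
- by have [[]|[]] := Y13p g (g + t *: (g0 : HD R)) t t0 (fun=> erefl); [left|right].
- by have [[]|[]] := Y13p g (g + t *: g0 : AD R) t t0 (fun=> erefl); [left|right].
- by have [[]|[]] := Y13p g (g + t *: g0 : AD R) t t0 (fun=> erefl); [left|right].
Qed.
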